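(* Let $(Y_n)$ satisfy Condition 1 with constant $\alpha$ and fix an integer $a\ge1$. For $i=1,\dots,a$ let $\pi_i(n)$ be the probability that the leader election process started with $n$ players and stopped as soon as at most $a$ players remain ends with exactly $i$ players. Then there are continuous, locally Lipschitz functions $\psi_i$ on $(0,\infty)$ with $\psi_i(\alpha t)=\psi_i(t)$ for all $t>0$, such that $\pi_i(n)=\psi_i(n)+o(1)$ as $n\to\infty$, for $i=1,\dots,a$.
   Context: Condition 1: $(Y_n)_{n\ge1}$ is a sequence of random variables with $1\le Y_n\le n$ for all $n$ and $\Pr(Y_n=n)<1$ for $n\ge2$, such that: (i) $\Pr(Y_n\le k)\ge\Pr(Y_{n+1}\le k)$ for all $n,k\ge1$; (ii) there are constants $\alpha\in(0,1)$, $\varepsilon>0$ and $\delta_n=O((\log n)^{-1-\varepsilon})$ with $\mathbb E Y_{n+1}-\mathbb E Y_n=\alpha+O(\delta_n)$; (iii) $\Pr(|Y_n-\alpha n|>\delta_n n)=O(n^{-2-\varepsilon})$. Leader election process: $N_0=n$ and $(N_k)$ is the Markov chain on $\{1,2,\dots\}$ with $\Pr(N_{k+1}=j\mid N_k=i)=\Pr(Y_i=j)$; the stopped process ends at the first $k$ with $N_k\le a$, with $N_k$ players. *)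

(* Defs.v *)
From Stdlib Require Import Reals Lra Lia Arith.
Open Scope R_scope.

(* A family of distributions: p n k = Pr(Y_n = k), for 1 <= k <= n. *)

Fixpoint sum_1n (n : nat) (f : nat -> R) : R :=
  match n with
  | O => 0
  | S m => sum_1n m f + f (S m)
  end.

Definition is_law (p : nat -> nat -> R) : Prop :=
  forall n : nat, (1 <= n)%nat ->
    (forall k, 0 <= p n k) /\ sum_1n n (p n) = 1.

Definition prob_le (p : nat -> nat -> R) (n k : nat) : R :=
  sum_1n n (fun j => if (j <=? k)%nat then p n j else 0).

Definition expect (p : nat -> nat -> R) (n : nat) : R :=
  sum_1n n (fun j => INR j * p n j).

Definition prob_dev (p : nat -> nat -> R) (alpha d : R) (n : nat) : R :=
  sum_1n n (fun j => if Rlt_dec (d * INR n) (Rabs (INR j - alpha * INR n))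
                     then p n j else 0).

Definition condition1 (p : nat -> nat -> R) (alpha : R) : Prop :=
  is_law p /\
  (forall n : nat, (2 <= n)%nat -> p n n < 1) /\
  (forall n k : nat, (1 <= n)%nat -> (1 <= k)%nat ->
     prob_le p (S n) k <= prob_le p n k) /\
  0 < alpha < 1 /\
  exists (eps : R) (delta : nat -> R),
    0 < eps /\
    (exists (C : R) (N : nat), forall n : nat, (N <= n)%nat -> (3 <= n)%nat ->
        Rabs (delta n) <= C * Rpower (ln (INR n)) (- 1 - eps)) /\
    (exists (C : R) (N : nat), forall n : nat, (N <= n)%nat -> (1 <= n)%nat ->
        Rabs (expect p (S n) - expect p n - alpha) <= C * Rabs (delta n)) /\
    (exists (C : R) (N : nat), forall n : nat, (N <= n)%nat -> (1 <= n)%nat ->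
        prob_dev p alpha (delta n) n <= C * Rpower (INR n) (- 2 - eps)).

(* Distribution of the leader election process stopped at the first time
   the number of players is <= a:
   stopped_prob p a k n i = Pr(N_{min(k,T)} = i | N_0 = n),
   where T = first k with N_k <= a. *)
Fixpoint stopped_prob (p : nat -> nat -> R) (a : nat) (k : nat) (n i : nat) : R :=
  match k with
  | O => if Nat.eqb n i then 1 else 0
  | S k' =>
      if (n <=? a)%nat then (if Nat.eqb n i then 1 else 0)
      else sum_1n n (fun j => p n j * stopped_prob p a k' j i)
  end.

Definition loc_lipschitz_pos (f : R -> R) : Prop :=
  forall t, 0 < t -> exists r L, 0 < r /\
    forall x y, 0 < x -> 0 < y -> Rabs (x - t) < r -> Rabs (y - t) < r ->
      Rabs (f x - f y) <= L * Rabs (x - y).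

(* Main.v *)
Require Import Defs.
From Stdlib Require Import Reals Lra Lia Arith ZArith.
From Coquelicot Require Import Coquelicot.
Open Scope R_scope.

(** For fixed [i] write [f n] for the probability of ending with [i] players, so
    that [f n = E f(Y_n)] for [n > a].  By monotonicity in [n] and Abel summation,
    [f(n+1) - f(n)] is an average, of total mass [alpha + O(W n)], of the increments
    [f(j+1) - f(j)] with [j] close to [alpha n], where [W n] is of order
    [(ln n)^(-1-eps)].  Since [W] is summable along geometric progressions,
    [n |f(n+1) - f(n)|] stays bounded.  Concentration of [Y_n] then gives
    [f(x) - f(alpha x) = O(W x)] for [f] extended to real arguments by rounding up,
    so [f(t / alpha^k)] converges as [k] grows; the limit [psi t] is invariant under
    [t -> alpha t] and inherits the Lipschitz bound, the rounding disappearing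
    after rescaling. *)

(** * Finite sums and summation by parts *)

Lemma sum_1n_ext n f g :
  (forall j, (1 <= j <= n)%nat -> f j = g j) -> sum_1n n f = sum_1n n g.
Proof.
induction n as [|n IH]; simpl; intros H; [reflexivity|].
rewrite IH, H; [reflexivity|lia|intros; apply H; lia].
Qed.

Lemma sum_1n_le n f g :
  (forall j, (1 <= j <= n)%nat -> f j <= g j) -> sum_1n n f <= sum_1n n g.
Proof.
induction n as [|n IH]; simpl; intros H; [lra|].
apply Rplus_le_compat; [apply IH; intros; apply H; lia|apply H; lia].
Qed.

Lemma sum_1n_plus n f g :
  sum_1n n (fun j => f j + g j) = sum_1n n f + sum_1n n g.
Proof. induction n as [|n IH]; simpl; [lra|rewrite IH; lra]. Qed.

Lemma sum_1n_scal n c f :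
  sum_1n n (fun j => c * f j) = c * sum_1n n f.
Proof. induction n as [|n IH]; simpl; [lra|rewrite IH; lra]. Qed.

Lemma sum_1n_const n c : sum_1n n (fun _ => c) = INR n * c.
Proof.
induction n as [|n IH]; [simpl; lra|].
rewrite S_INR; simpl; rewrite IH; lra.
Qed.

Lemma sum_1n_Rabs n f : Rabs (sum_1n n f) <= sum_1n n (fun j => Rabs (f j)).
Proof.
induction n as [|n IH]; simpl; [rewrite Rabs_R0; lra|].
eapply Rle_trans; [apply Rabs_triang|lra].
Qed.

Lemma sum_1n_nonneg n f :
  (forall j, (1 <= j <= n)%nat -> 0 <= f j) -> 0 <= sum_1n n f.
Proof.
intros H; replace 0 with (sum_1n n (fun _ => 0)).
- now apply sum_1n_le.
- rewrite sum_1n_const; lra.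
Qed.

Lemma sum_1n_cv n (u : nat -> nat -> R) (l : nat -> R) :
  (forall j, (1 <= j <= n)%nat -> Un_cv (fun k => u k j) (l j)) ->
  Un_cv (fun k => sum_1n n (u k)) (sum_1n n l).
Proof.
induction n as [|n IH]; simpl; intros H.
- intros e He; exists 0%nat; intros; unfold Rdist; rewrite Rminus_diag, Rabs_R0; lra.
- apply (CV_plus (fun k => sum_1n n (u k)) (fun k => u k (S n))); [apply IH|]; intros; apply H; lia.
Qed.

Lemma abel_sum_1n n f g :
  sum_1n n (fun j => g j * f j) =
  sum_1n n g * f (S n) - sum_1n n (fun j => sum_1n j g * (f (S j) - f j)).
Proof. induction n as [|n IH]; simpl; [lra|rewrite IH; simpl; lra]. Qed.

Lemma sum_1n_prefix g m n : (m <= n)%nat ->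
  sum_1n n (fun j => if (j <=? m)%nat then g j else 0) = sum_1n m g.
Proof.
induction n as [|n IH]; intros H.
- now replace m with 0%nat by lia.
- destruct (Nat.eq_dec m (S n)) as [->|Hm].
  + apply sum_1n_ext; intros j Hj; destruct (Nat.leb_spec j (S n)); [reflexivity|lia].
  + cbn [sum_1n]; rewrite IH by lia.
    destruct (Nat.leb_spec (S n) m); [lia|lra].
Qed.

(** Abel summation of both means leaves the same boundary value [f (S n)], which cancels. Condition
    (i) makes the weights on the right nonnegative, and taking the identity for [f] shows that their
    total mass is the increment of the mean. *)
Lemma mean_increment p n f : is_law p -> (1 <= n)%nat ->
  sum_1n (S n) (fun j => p (S n) j * f j) - sum_1n n (fun j => p n j * f j) =
  sum_1n n (fun j => (prob_le p n j - prob_le p (S n) j) * (f (S j) - f j)).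
Proof.
intros Hp Hn.
destruct (Hp n Hn) as [_ H1]; destruct (Hp (S n)) as [_ H2]; [lia|].
rewrite (abel_sum_1n (S n) f (p (S n))), (abel_sum_1n n f (p n)), H1, H2.
assert (HS : forall g, sum_1n (S n) g = sum_1n n g + g (S n)) by reflexivity.
rewrite (HS (fun j => _)), H2.
rewrite (sum_1n_ext n (fun j => (prob_le p n j - prob_le p (S n) j) * (f (S j) - f j))
  (fun j => sum_1n j (p n) * (f (S j) - f j) + (-1) * (sum_1n j (p (S n)) * (f (S j) - f j)))).
- rewrite sum_1n_plus, sum_1n_scal; lra.
- intros j Hj; unfold prob_le; rewrite 2!sum_1n_prefix by lia; lra.
Qed.

(** * Tails of the law against deviation probabilities *)

Lemma prob_le_nonneg p n k : is_law p -> (1 <= n)%nat -> 0 <= prob_le p n k.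
Proof.
intros Hp Hn; apply sum_1n_nonneg; intros j _.
destruct (Nat.leb_spec j k); [apply Hp; lia|lra].
Qed.

Lemma prob_le_le1 p n k : is_law p -> (1 <= n)%nat -> prob_le p n k <= 1.
Proof.
intros Hp Hn; destruct (Hp n Hn) as [H0 <-]; apply sum_1n_le; intros j _.
destruct (Nat.leb_spec j k); [lra|apply H0].
Qed.

Lemma prob_dev_antitone p al d1 d2 n : is_law p -> (1 <= n)%nat -> d1 <= d2 ->
  prob_dev p al d2 n <= prob_dev p al d1 n.
Proof.
intros Hp Hn Hd; apply sum_1n_le; intros j _.
assert (0 <= p n j) by (apply Hp; lia).
assert (d1 * INR n <= d2 * INR n) by (apply Rmult_le_compat_r; [apply pos_INR|lra]).
destruct (Rlt_dec _ _); destruct (Rlt_dec _ _); lra.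
Qed.

Lemma prob_le_dev p al d n k : is_law p -> (1 <= n)%nat ->
  INR k < al * INR n - d * INR n -> prob_le p n k <= prob_dev p al d n.
Proof.
intros Hp Hn Hk; apply sum_1n_le; intros j _.
assert (0 <= p n j) by (apply Hp; lia).
destruct (Nat.leb_spec j k) as [H1|H1]; destruct (Rlt_dec _ _) as [H2|H2]; try lra.
apply le_INR in H1; exfalso; apply H2; rewrite Rabs_left1.
- lra.
(* The radius [d * INR n] may be negative; then every [j] counts as deviating. *)
- destruct (Rle_dec 0 (d * INR n)); [lra|exfalso].
  apply H2; eapply Rlt_le_trans; [|apply Rabs_pos]; lra.
Qed.

Lemma prob_gt_dev p al d n k : is_law p -> (1 <= n)%nat ->
  al * INR n + d * INR n <= INR k -> 1 - prob_le p n k <= prob_dev p al d n.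
Proof.
intros Hp Hn Hk; apply Rle_minus_l; destruct (Hp n Hn) as [H0 <-].
unfold prob_dev, prob_le; rewrite <- sum_1n_plus.
apply sum_1n_le; intros j _; specialize (H0 j).
destruct (Nat.leb_spec j k) as [H1|H1]; destruct (Rlt_dec _ _) as [H2|H2]; try lra.
apply lt_INR in H1; exfalso; apply H2.
eapply Rlt_le_trans; [|apply Rle_abs]; lra.
Qed.

(** * Powers of the logarithm *)

Lemma ln_le_minus1 x : 0 < x -> ln x <= x - 1.
Proof. intros Hx; pose proof (exp_ineq1_le (ln x)) as H; rewrite exp_ln in H; lra. Qed.

Lemma ln_gt_0 x : 1 < x -> 0 < ln x.
Proof. intros Hx; rewrite <- ln_1; apply ln_increasing; lra. Qed.

Lemma ln_monotone x y : 0 < x -> x <= y -> ln x <= ln y.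
Proof. intros Hx [H| ->]; [left; now apply ln_increasing|lra]. Qed.

Lemma exp_monotone x y : x <= y -> exp x <= exp y.
Proof. intros [H| ->]; [left; now apply exp_increasing|lra]. Qed.

Lemma Rpower_ln_antitone s x y : 0 <= s -> 1 < x -> x <= y ->
  Rpower (ln y) (- s) <= Rpower (ln x) (- s).
Proof.
intros Hs Hx Hxy; unfold Rpower.
assert (0 < ln x) by now apply ln_gt_0.
assert (ln x <= ln y) by (apply ln_monotone; lra).
assert (ln (ln x) <= ln (ln y)) by (apply ln_monotone; lra).
apply exp_monotone; nra.
Qed.

Lemma Rpower_ln_small s eta : 0 < s -> 0 < eta ->
  exists X, 1 < X /\ forall x, X <= x -> Rpower (ln x) (- s) <= eta.
Proof.
intros Hs He.
assert (H : 0 < exp (- ln eta / s)) by apply exp_pos.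
(* This point solves [Rpower (ln x) (- s) = eta]. *)
exists (exp (exp (- ln eta / s))); split.
- rewrite <- exp_0; now apply exp_increasing.
- intros x Hx; eapply Rle_trans; [apply Rpower_ln_antitone; [lra| |apply Hx]|].
  + rewrite <- exp_0; now apply exp_increasing.
  + unfold Rpower; rewrite 2!ln_exp.
    replace (- s * (- ln eta / s)) with (ln eta) by (field; lra).
    rewrite exp_ln; lra.
Qed.

(* The telescoping bound: errors of order [ln x ^ (-1-eps)] are increments,
   along geometric progressions, of the vanishing function [ln x ^ (-eps)]. *)
Lemma Rpower_ln_increment eps c x : 0 < eps -> 0 < c < 1 -> 1 < c * x ->
  eps * (- ln c) * Rpower (ln x) (-1 - eps) <=
  Rpower (ln (c * x)) (- eps) - Rpower (ln x) (- eps).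
Proof.
intros He Hc Hcx.
assert (Hx : 0 < x) by nra.
assert (Hv : 0 < ln (c * x)) by now apply ln_gt_0.
assert (Hcn : ln c < 0) by (rewrite <- ln_1; apply ln_increasing; lra).
assert (Hl : ln (c * x) = ln c + ln x) by (apply ln_mult; lra).
set (u := ln x) in *; set (v := ln (c * x)) in *.
assert (Hu : 0 < u) by lra.
replace (-1 - eps) with (- eps + - (1)) by ring.
rewrite Rpower_plus, (Rpower_Ropp u 1), Rpower_1 by lra.
assert (Hr : Rpower v (- eps) = Rpower u (- eps) * exp (- eps * ln (v / u))).
{ unfold Rpower; rewrite <- exp_plus; f_equal; rewrite ln_div by lra; ring. }
rewrite Hr.
assert (H1 : ln (v / u) <= ln c / u).
{ eapply Rle_trans; [apply ln_le_minus1, Rdiv_lt_0_compat; lra|].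
  right; rewrite Hl; field; lra. }
pose proof (exp_ineq1_le (- eps * ln (v / u))) as H2.
assert (H3 : 0 < Rpower u (- eps)) by apply exp_pos.
assert (H4 : eps * - ln c * / u <= - eps * ln (v / u)).
{ unfold Rdiv in H1 at 2; nra. }
nra.
Qed.

(** Polynomial decay is absorbed into logarithmic decay. The constant comes from
    [ln (s * u) <= s * u - 1] at [u = ln x], with [s] chosen so that [(1 + eps) * s = eps]. *)
Lemma Rpower_le_Rpower_ln eps x : 0 < eps -> 1 < x ->
  Rpower x (- eps) <=
  exp ((1 + eps) * (- 1 - ln (eps / (1 + eps)))) * Rpower (ln x) (-1 - eps).
Proof.
intros He Hx; unfold Rpower; rewrite <- exp_plus; apply exp_monotone.
assert (Hu : 0 < ln x) by now apply ln_gt_0.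
set (u := ln x) in *; set (s := eps / (1 + eps)).
assert (Hs : 0 < s) by (apply Rdiv_lt_0_compat; lra).
assert (H1 : ln (s * u) <= s * u - 1) by (apply ln_le_minus1, Rmult_lt_0_compat; lra).
rewrite ln_mult in H1 by lra.
assert (H2 : eps = (1 + eps) * s) by (unfold s; field; lra).
rewrite H2 at 1; nra.
Qed.

(** * A common error function for Condition 1 *)

(* One function dominating every error term of Condition 1: [delta_n], the error
   of the mean increments, [n^2] times the deviation probability, and [1/n]. *)
Definition log_error C eps x := C * Rpower (ln x) (-1 - eps).

(** The last bound serves to absorb unit shifts, from [n] to [S n] or from rounding, into multiples
    of [w * n], where [w] is the error at [n]. *)
Lemma condition1_log_error p al : condition1 p al ->
  exists eps C N, 0 < eps /\ 0 < C /\
    forall n, (N <= n)%nat ->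
      expect p (S n) - expect p n <= al + log_error C eps (INR n) /\
      prob_dev p al (log_error C eps (INR n)) n
        <= log_error C eps (INR n) * / (INR n * INR n) /\
      1 <= log_error C eps (INR n) * INR n.
Proof.
intros (Hp & _ & _ & Hal & e0 & delta & He0 & (C1 & N1 & H1) & (C2 & N2 & H2) & (C3 & N3 & H3)).
(* Capping the exponent at 1 makes [Rpower n (- eps)] dominate [1 / n], so one function also covers
   that error. *)
set (eps := Rmin e0 1).
assert (Heps : 0 < eps) by (unfold eps; apply Rmin_glb_lt; lra).
assert (Heps1 : eps <= 1) by apply Rmin_r.
assert (Hepse : eps <= e0) by apply Rmin_l.
set (c := exp ((1 + eps) * (- 1 - ln (eps / (1 + eps))))).
assert (Hc : 0 < c) by apply exp_pos.
(* After the 1, which ensures positivity, the summands pay in turn for [delta], the mean increment,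
   the deviation probability and [1 / n]. *)
set (C := 1 + Rabs C1 + Rabs C1 * Rabs C2 + Rabs C3 * c + c).
pose proof (Rabs_pos C1); pose proof (Rabs_pos C2); pose proof (Rabs_pos C3).
assert (0 <= Rabs C1 * Rabs C2) by (apply Rmult_le_pos; lra).
assert (0 <= Rabs C3 * c) by (apply Rmult_le_pos; lra).
exists eps, C, (N1 + N2 + N3 + 3)%nat.
split; [lra|split; [unfold C; lra|]]; intros n Hn.
assert (Hn3 : 3 <= INR n) by (replace 3 with (INR 3) by (simpl; lra); apply le_INR; lia).
assert (Hln : 1 <= ln (INR n)).
{ rewrite <- (ln_exp 1); apply ln_monotone; [apply exp_pos|].
  pose proof exp_le_3; lra. }
unfold log_error; set (w := Rpower (ln (INR n)) (-1 - eps)).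
assert (Hw : 0 < w) by apply exp_pos.
assert (Hw0 : Rpower (ln (INR n)) (-1 - e0) <= w) by (apply Rle_Rpower; lra).
assert (Hwn : Rpower (INR n) (- eps) <= c * w) by (apply Rpower_le_Rpower_ln; lra).
assert (Hd : Rabs (delta n) <= Rabs C1 * w).
{ eapply Rle_trans; [apply H1; lia|].
  pose proof (Rle_abs C1).
  assert (0 < Rpower (ln (INR n)) (-1 - e0)) by apply exp_pos.
  nra. }
split; [|split].
- assert (HE := H2 n ltac:(lia) ltac:(lia)).
  apply Rabs_le_between in HE.
  pose proof (Rle_abs C2); pose proof (Rabs_pos (delta n)).
  assert (C2 * Rabs (delta n) <= Rabs C2 * (Rabs C1 * w)) by nra.
  unfold C; nra.
- eapply Rle_trans; [apply prob_dev_antitone with (d1 := delta n); [assumption|lia|]|].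
  + pose proof (Rle_abs (delta n)); unfold C; nra.
  + eapply Rle_trans; [apply H3; lia|].
    replace (-2 - e0) with (- (1 + 1) + - e0) by ring.
    rewrite Rpower_plus, (Rpower_Ropp _ (1 + 1)), Rpower_plus, Rpower_1 by lra.
    assert (HR : Rpower (INR n) (- e0) <= c * w).
    { eapply Rle_trans; [apply Rle_Rpower with (m := - eps); lra|exact Hwn]. }
    assert (HP : 0 < Rpower (INR n) (- e0)) by apply exp_pos.
    assert (Hi : 0 < / (INR n * INR n)) by (apply Rinv_0_lt_compat; nra).
    assert (HC : C3 * Rpower (INR n) (- e0) <= C * w).
    { pose proof (Rle_abs C3).
      assert (C3 * Rpower (INR n) (- e0) <= Rabs C3 * (c * w)) by nra.
      unfold C; nra. }
    nra.
- assert (HR : Rpower (INR n) (- (1)) <= Rpower (INR n) (- eps)) by (apply Rle_Rpower; lra).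
  rewrite Rpower_Ropp, Rpower_1 in HR by lra.
  assert (Hinv : / INR n <= C * w) by (unfold C; nra).
  replace 1 with (/ INR n * INR n) by (field; lra).
  apply Rmult_le_compat_r; lra.
Qed.

Lemma log_error_pos C eps x : 0 < C -> 0 < log_error C eps x.
Proof. intros HC; apply Rmult_lt_0_compat; [assumption|apply exp_pos]. Qed.

Lemma log_error_antitone C eps x y : 0 < C -> 0 < eps -> 1 < x -> x <= y ->
  log_error C eps y <= log_error C eps x.
Proof.
intros HC He Hx Hxy; apply Rmult_le_compat_l; [lra|].
replace (-1 - eps) with (- (1 + eps)) by ring.
apply Rpower_ln_antitone; lra.
Qed.

Lemma log_error_small C eps eta : 0 < C -> 0 < eps -> 0 < eta ->
  exists X, 1 < X /\ forall x, X <= x -> log_error C eps x <= eta.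
Proof.
intros HC He Ht.
destruct (Rpower_ln_small (1 + eps) (eta / C)) as (X & HX & H); [lra| |].
- now apply Rdiv_lt_0_compat.
- exists X; split; [assumption|]; intros x Hx; unfold log_error.
  replace (-1 - eps) with (- (1 + eps)) by ring.
  replace eta with (C * (eta / C)) by (field; lra).
  apply Rmult_le_compat_l; [lra|auto].
Qed.

(** * Boundedness of [n |f(n+1) - f(n)|] *)

(** To the right of the window, [Y_(n+1) > j] is a deviation at [n + 1]; to the left, [Y_n <= j] is
    a deviation at [n]. The factor 4 leaves room for the shift of the centre and radius:
    [al + w' * (n + 1) <= 3 * w * n]. *)
Lemma prob_le_diff_outlier p al w w' n j :
  is_law p -> (1 <= n)%nat -> 0 < al < 1 -> 0 <= w' <= w -> 1 <= w * INR n ->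
  prob_dev p al w n <= w * / (INR n * INR n) ->
  prob_dev p al w' (S n) <= w' * / (INR (S n) * INR (S n)) ->
  4 * w * INR n < Rabs (INR j - al * INR n) ->
  prob_le p n j - prob_le p (S n) j <= w * / (INR n * INR n).
Proof.
intros Hp Hn Hal Hw Hwn Hd Hd' Hj.
assert (Hn1 : 1 <= INR n) by (apply (le_INR 1); lia).
assert (HSn : INR (S n) = INR n + 1) by apply S_INR.
pose proof (prob_le_nonneg p (S n) j Hp ltac:(lia)).
pose proof (prob_le_le1 p n j Hp Hn).
destruct (Rle_dec (al * INR n) (INR j)) as [Hle|Hle].
- rewrite Rabs_right in Hj by lra.
  assert (Hi : / (INR (S n) * INR (S n)) <= / (INR n * INR n))
    by (apply Rinv_le_contravar; nra).
  assert (0 < / (INR (S n) * INR (S n))) by (apply Rinv_0_lt_compat; nra).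
  assert (Hout : 1 - prob_le p (S n) j <= prob_dev p al w' (S n)).
  { apply prob_gt_dev; [assumption|lia|].
    rewrite HSn; nra. }
  nra.
- rewrite Rabs_left in Hj by lra.
  assert (Hout : prob_le p n j <= prob_dev p al w n) by (apply prob_le_dev; [assumption|lia|nra]).
  lra.
Qed.

(** Inside the window the weights have total mass at most [al + w] and meet increments at most [M].
    Outside it there are at most [n] weights, each at most [w / n^2], meeting increments at most
    1. *)
Lemma increment_step p f al w w' M n :
  is_law p -> (1 <= n)%nat -> 0 < al < 1 -> 0 <= w' <= w -> 1 <= w * INR n ->
  prob_dev p al w n <= w * / (INR n * INR n) ->
  prob_dev p al w' (S n) <= w' * / (INR (S n) * INR (S n)) ->
  expect p (S n) - expect p n <= al + w ->
  (forall k, (1 <= k)%nat -> prob_le p (S n) k <= prob_le p n k) ->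
  f n = sum_1n n (fun j => p n j * f j) ->
  f (S n) = sum_1n (S n) (fun j => p (S n) j * f j) ->
  0 <= M ->
  (forall j, (1 <= j)%nat -> Rabs (f (S j) - f j) <= 1) ->
  (forall j, (1 <= j <= n)%nat -> Rabs (INR j - al * INR n) <= 4 * w * INR n ->
     Rabs (f (S j) - f j) <= M) ->
  Rabs (f (S n) - f n) <= M * (al + w) + w / INR n.
Proof.
intros Hp Hn Hal Hw Hwn Hd Hd' HE Hmon Hf HfS HM H1 Hin.
assert (Hn1 : 1 <= INR n) by (apply (le_INR 1); lia).
assert (HQ : sum_1n n (fun j => prob_le p n j - prob_le p (S n) j) <= al + w).
{ eapply Rle_trans; [right|exact HE].
  unfold expect.
  rewrite (sum_1n_ext (S n) (fun j => INR j * _) (fun j => p (S n) j * INR j))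
    by (intros; ring).
  rewrite (sum_1n_ext n (fun j => INR j * _) (fun j => p n j * INR j))
    by (intros; ring).
  rewrite mean_increment by assumption.
  apply sum_1n_ext; intros j _; rewrite S_INR; ring. }
rewrite HfS, Hf, mean_increment by assumption.
eapply Rle_trans; [apply sum_1n_Rabs|].
apply Rle_trans with
  (sum_1n n (fun j => M * (prob_le p n j - prob_le p (S n) j) + w * / (INR n * INR n))).
- apply sum_1n_le; intros j Hj.
  specialize (Hmon j ltac:(lia)); specialize (H1 j ltac:(lia)).
  rewrite Rabs_mult, Rabs_right by lra.
  pose proof (Rabs_pos (f (S j) - f j)).
  destruct (Rle_dec (Rabs (INR j - al * INR n)) (4 * w * INR n)) as [Hle|Hle].
  + specialize (Hin j Hj Hle).
    assert (0 < / (INR n * INR n)) by (apply Rinv_0_lt_compat; nra).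
    nra.
  + apply Rnot_le_lt in Hle.
    pose proof (prob_le_diff_outlier p al w w' n j Hp Hn Hal Hw Hwn Hd Hd' Hle).
    nra.
- rewrite sum_1n_plus, sum_1n_scal, sum_1n_const.
  replace (INR n * (w * / (INR n * INR n))) with (w / INR n) by (field; lra).
  apply Rplus_le_compat_r, Rmult_le_compat_l; assumption.
Qed.

Lemma increment_bound p al a f : condition1 p al ->
  (forall n, (1 <= n)%nat -> 0 <= f n <= 1) ->
  (forall n, (a < n)%nat -> f n = sum_1n n (fun j => p n j * f j)) ->
  exists K, 0 < K /\ forall n, (1 <= n)%nat -> INR n * Rabs (f (S n) - f n) <= K.
Proof.
intros Hc Hf01 Hf.
destruct (condition1_log_error p al Hc) as (eps & C & N & He & HC & HN).
destruct Hc as (Hp & _ & Hmon & Hal & _).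
assert (H1 : forall j, (1 <= j)%nat -> Rabs (f (S j) - f j) <= 1).
{ intros j Hj; pose proof (Hf01 j Hj); pose proof (Hf01 (S j) ltac:(lia)).
  apply Rabs_le; lra. }
(* For small [w] the window around [al * x] lies below [b * x], hence below [x], which lets the
   induction hypothesis apply there. *)
set (b := (1 + al) / 2).
assert (Hb : al < b < 1) by (unfold b; lra).
set (L := eps * - ln b).
assert (HL : 0 < L).
{ apply Rmult_lt_0_compat; [lra|].
  assert (ln b < 0) by (rewrite <- ln_1; apply ln_increasing; lra); lra. }
(* With [v = w / al], the ratio of masses costs [10 * v] times [G <= 2], and the outliers cost at
   most one more [v]: in all [21 * v]. *)
set (A := 21 * C / (al * L)).
assert (HA : 0 < A) by (apply Rdiv_lt_0_compat; nra).
set (h := fun x => Rpower (ln x) (- eps)).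
(* These bounds on [w] give [al - 4 * w >= al / 2] and [al + 4 * w <= b]. *)
destruct (log_error_small C eps (Rmin (al / 8) ((1 - al) / 8))) as (X1 & HX1 & Hs1);
  [assumption|assumption|apply Rmin_glb_lt; lra|].
destruct (Rpower_ln_small eps (/ A)) as (X2 & HX2 & Hs2);
  [assumption|now apply Rinv_0_lt_compat|].
set (X := Rmax X1 X2).
assert (HX : 1 < X) by (eapply Rlt_le_trans; [exact HX1|apply Rmax_l]).
(* [K * G] is a bounded supersolution of the recursion for [n |f(n+1) - f(n)|]:
   the gain [G x - G (b x)] exceeds the error term by the choice of [A]. *)
set (G := fun x => 2 - A * h x).
assert (HG : forall x, X <= x -> 1 <= G x <= 2).
{ intros x Hx; assert (h x <= / A).
  { apply Hs2; eapply Rle_trans; [apply Rmax_r|exact Hx]. }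
  assert (0 < h x) by apply exp_pos.
  assert (A * h x <= A * / A) by (apply Rmult_le_compat_l; lra).
  rewrite Rinv_r in H2 by lra.
  unfold G; split; [lra|]; assert (0 < A * h x) by nra; lra. }
assert (HGm : forall x y, X <= x -> x <= y -> G x <= G y).
{ intros x y Hx Hy; unfold G.
  assert (h y <= h x) by (apply Rpower_ln_antitone; lra); nra. }
(* Beyond [n0] the whole window stays above [X]. Below [n1] the trivial bound 1 on increments gives
   the claim with [K = n1]. *)
destruct (INR_unbounded (2 * X / al)) as [n0 Hn0].
set (n1 := (n0 + N + a + 2)%nat).
set (K := INR n1).
assert (HK : 1 <= K) by (apply (le_INR 1); unfold n1; lia).
assert (Hbase : forall n, (1 <= n)%nat -> (n < n1)%nat -> INR n * Rabs (f (S n) - f n) <= K).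
{ intros n Hn Hlt; specialize (H1 n Hn); apply lt_INR in Hlt; fold K in Hlt.
  pose proof (pos_INR n); pose proof (Rabs_pos (f (S n) - f n)); nra. }
assert (Hmain : forall n, (1 <= n)%nat -> X <= INR n ->
  INR n * Rabs (f (S n) - f n) <= K * G (INR n)).
{ induction n as [n IH] using lt_wf_ind; intros Hn HXn.
  pose proof (HG _ HXn) as HGn.
  destruct (Nat.lt_ge_cases n n1) as [Hlt|Hge].
  { pose proof (Hbase n Hn Hlt); nra. }
  set (x := INR n) in *.
  assert (Hx0 : INR n0 <= x) by (apply le_INR; unfold n1 in Hge; lia).
  assert (Hxal : X <= al * x / 2).
  { apply Rmult_le_reg_l with (2 / al); [apply Rdiv_lt_0_compat; lra|].
    replace (2 / al * (al * x / 2)) with x by (field; lra).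
    replace (2 / al * X) with (2 * X / al) by (field; lra); lra. }
  destruct (HN n ltac:(unfold n1 in Hge; lia)) as (HE & Hd & Hwn).
  destruct (HN (S n) ltac:(unfold n1 in Hge; lia)) as (_ & Hd' & _).
  fold x in HE, Hd, Hwn.
  set (w := log_error C eps x) in *.
  set (w' := log_error C eps (INR (S n))) in *.
  assert (Hw' : 0 <= w' <= w).
  { split; [left; now apply log_error_pos|].
    apply log_error_antitone; try lra; unfold x; rewrite S_INR; lra. }
  assert (Hws : w <= Rmin (al / 8) ((1 - al) / 8)).
  { apply Hs1; eapply Rle_trans; [apply Rmax_l|exact HXn]. }
  assert (Hwa : w <= al / 8) by (eapply Rle_trans; [exact Hws|apply Rmin_l]).
  assert (Hwb : w <= (1 - al) / 8) by (eapply Rle_trans; [exact Hws|apply Rmin_r]).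
  assert (Hbx : X <= b * x) by nra.
  pose proof (HG _ Hbx) as HGb.
  assert (Hden : 0 < (al - 4 * w) * x) by nra.
  (* The induction hypothesis at [j] in the window, with [j] bounded below in the denominator and
     above inside the increasing [G]. *)
  set (M := K * G (b * x) / ((al - 4 * w) * x)).
  assert (HM : 0 <= M) by (left; apply Rdiv_lt_0_compat; nra).
  assert (Hstep : Rabs (f (S n) - f n) <= M * (al + w) + w / x).
  { apply increment_step with (p := p) (w' := w'); try assumption.
    - intros k Hk; apply Hmon; lia.
    - apply Hf; unfold n1 in Hge; lia.
    - apply Hf; unfold n1 in Hge; lia.
    - fold x; intros j Hj Hjx; apply Rabs_le_between in Hjx.
      assert (Hj1 : (al - 4 * w) * x <= INR j) by lra.
      assert (Hj2 : INR j <= b * x) by (unfold b; nra).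
      assert (HXj : X <= INR j) by nra.
      assert (Hjn : (j < n)%nat) by (apply INR_lt; fold x; nra).
      pose proof (IH j Hjn ltac:(lia) HXj) as IHj.
      pose proof (HGm _ _ HXj Hj2).
      apply Rle_div_r; [lra|].
      pose proof (Rabs_pos (f (S j) - f j)); nra. }
  assert (HGstep : A * L * (w / C) <= G x - G (b * x)).
  { pose proof (Rpower_ln_increment eps b x He ltac:(lra) ltac:(lra)) as Hi.
    fold L in Hi.
    replace (w / C) with (Rpower (ln x) (-1 - eps)) by (unfold w, log_error; field; lra).
    unfold G, h; nra. }
  replace (A * L * (w / C)) with (21 * (w / al)) in HGstep
    by (unfold A; field; repeat split; lra).
  (* In terms of [v] this is [1 + v <= (1 + 10 * v) * (1 - 4 * v)], which for [v >= 0] holds as long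
     as [v <= 1/8]. *)
  assert (Hratio : (al + w) / (al - 4 * w) <= 1 + 10 * (w / al)).
  { apply Rle_div_l; [lra|].
    set (v := w / al).
    assert (Hv : w = v * al) by (unfold v; field; lra).
    rewrite Hv in Hwa |- *.
    assert (0 <= v) by (apply Rdiv_le_0_compat; lra).
    assert (v <= / 8) by nra.
    nra. }
  apply Rle_trans with (K * G (b * x) * ((al + w) / (al - 4 * w)) + w).
  - apply Rle_trans with (x * (M * (al + w) + w / x)).
    + apply Rmult_le_compat_l; lra.
    + right; unfold M; field; lra.
  - assert (Hwv : w <= w / al).
    { apply (Rle_div_r w w al); [lra|].
      rewrite <- (Rmult_1_r w) at 2; apply Rmult_le_compat_l; lra. }
    set (v := w / al) in *.
    assert (Hv : 0 <= v) by lra.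
    assert (HM1 : K * G (b * x) * ((al + w) / (al - 4 * w)) <=
            K * G (b * x) * (1 + 10 * v))
      by (apply Rmult_le_compat_l; [apply Rmult_le_pos; lra|assumption]).
    assert (HM2 : G (b * x) * v <= 2 * v) by (apply Rmult_le_compat_r; lra).
    assert (HM3 : 1 * v <= K * v) by (apply Rmult_le_compat_r; lra).
    assert (HM4 : K * (G (b * x) * (1 + 10 * v) + v) <= K * G x)
      by (apply Rmult_le_compat_l; lra).
    lra. }
exists (2 * K); split; [lra|]; intros n Hn.
destruct (Nat.lt_ge_cases n n1) as [Hlt|Hge].
- pose proof (Hbase n Hn Hlt); lra.
- assert (HXn : X <= INR n).
  { assert (INR n0 <= INR n) by (apply le_INR; unfold n1 in Hge; lia).
    assert (2 * X / al >= X); [|lra].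
    apply Rle_ge, Rle_div_r; nra. }
  pose proof (Hmain n Hn HXn); pose proof (HG _ HXn); nra.
Qed.

(** * Lipschitz bounds and rounding of real arguments *)

Lemma lipschitz_of_increments f K m n : 0 <= K ->
  (forall n, (1 <= n)%nat -> INR n * Rabs (f (S n) - f n) <= K) ->
  (1 <= m)%nat -> (m <= n)%nat ->
  Rabs (f n - f m) <= K * (INR n - INR m) / INR m.
Proof.
intros HK Hf Hm.
assert (Hm1 : 1 <= INR m) by (apply (le_INR 1); lia).
induction 1 as [|n Hmn IH].
- rewrite 2!Rminus_diag, Rabs_R0; right; field; lra.
- specialize (Hf n ltac:(lia)); apply le_INR in Hmn; rewrite S_INR.
  replace (f (S n) - f m) with ((f (S n) - f n) + (f n - f m)) by ring.
  eapply Rle_trans; [apply Rabs_triang|].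
  assert (Rabs (f (S n) - f n) <= K / INR m).
  { apply Rle_div_r; [lra|].
    pose proof (Rabs_pos (f (S n) - f n)); nra. }
  replace (K * (INR n + 1 - INR m) / INR m)
    with (K / INR m + K * (INR n - INR m) / INR m) by (field; lra).
  lra.
Qed.

Lemma lipschitz_of_increments_above f K m n z : 0 <= K ->
  (forall n, (1 <= n)%nat -> INR n * Rabs (f (S n) - f n) <= K) ->
  0 < z -> z <= INR m -> z <= INR n ->
  Rabs (f n - f m) <= K * Rabs (INR n - INR m) / z.
Proof.
intros HK Hf Hz.
assert (Hw : forall m n, (m <= n)%nat -> z <= INR m ->
  Rabs (f n - f m) <= K * Rabs (INR n - INR m) / z).
{ clear m n; intros m n Hmn Hzm.
  eapply Rle_trans; [apply lipschitz_of_increments with (K := K); try assumption|].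
  - apply INR_lt; simpl; lra.
  - apply le_INR in Hmn; rewrite (Rabs_right (INR n - INR m)) by lra.
    apply Rmult_le_compat_l; [apply Rmult_le_pos; lra|].
    apply Rinv_le_contravar; lra. }
intros Hm Hn; destruct (Nat.le_ge_cases m n) as [H|H].
- now apply Hw.
- rewrite (Rabs_minus_sym (f n)), (Rabs_minus_sym (INR n)); now apply Hw.
Qed.

(** [up x] is the integer strictly above [x], so positive reals go to indices at least 1, and an
    integer [n >= 0] goes to [n + 1]. *)
Definition nat_above (x : R) : nat := Z.to_nat (up x).

Lemma nat_above_spec x : 0 < x -> x < INR (nat_above x) <= x + 1.
Proof.
intros Hx; destruct (archimed x) as [H1 H2].
unfold nat_above; rewrite INR_IZR_INZ, Z2Nat.id; [lra|].
apply le_IZR; lra.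
Qed.

Lemma lipschitz_nat_above f K x y z : 0 <= K ->
  (forall n, (1 <= n)%nat -> INR n * Rabs (f (S n) - f n) <= K) ->
  0 < z -> z <= x -> z <= y ->
  Rabs (f (nat_above x) - f (nat_above y)) <= K * (Rabs (x - y) + 1) / z.
Proof.
intros HK Hf Hz Hx Hy.
pose proof (nat_above_spec x ltac:(lra)); pose proof (nat_above_spec y ltac:(lra)).
eapply Rle_trans; [apply lipschitz_of_increments_above with (K := K) (z := z); try assumption; lra|].
apply Rmult_le_compat_r; [left; now apply Rinv_0_lt_compat|].
apply Rmult_le_compat_l; [assumption|].
apply Rabs_le; pose proof (Rabs_maj2 (x - y)); pose proof (Rle_abs (x - y)); lra.
Qed.

(** * The defect of invariance under scaling by [al] *)

(** The window may contain no index, in which case [B] may be negative; hence [Rmax B 0]. *)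
Lemma mean_near p f al d n c B : is_law p -> (1 <= n)%nat ->
  (forall j, (1 <= j)%nat -> Rabs (f j - c) <= 1) ->
  (forall j, (1 <= j)%nat -> Rabs (INR j - al * INR n) <= d * INR n -> Rabs (f j - c) <= B) ->
  Rabs (sum_1n n (fun j => p n j * f j) - c) <= Rmax B 0 + prob_dev p al d n.
Proof.
intros Hp Hn H1 HB; destruct (Hp n Hn) as [H0 Hs].
replace (sum_1n n (fun j => p n j * f j) - c) with (sum_1n n (fun j => p n j * (f j - c))).
2:{ rewrite (sum_1n_ext n _ (fun j => p n j * f j + (- c) * p n j)) by (intros; ring).
    rewrite sum_1n_plus, sum_1n_scal, Hs; ring. }
eapply Rle_trans; [apply sum_1n_Rabs|].
rewrite <- (Rmult_1_r (Rmax B 0)), <- Hs, <- sum_1n_scal.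
unfold prob_dev; rewrite <- sum_1n_plus; apply sum_1n_le; intros j Hj.
specialize (H0 j); specialize (H1 j ltac:(lia)); specialize (HB j ltac:(lia)).
rewrite Rabs_mult, Rabs_right by lra.
pose proof (Rmax_l B 0); pose proof (Rmax_r B 0).
destruct (Rlt_dec _ _) as [H3|H3].
- nra.
- apply Rnot_lt_le in H3; specialize (HB H3); nra.
Qed.

(** [f n] averages values of [f] at indices near [al * n], so concentration and the Lipschitz bound
    give an error of order [log_error]. It is stated as an increment of [ln^(-eps)] so that it
    telescopes along [t / al^k]. *)
Lemma scaling_defect p al a f K : condition1 p al -> 0 <= K ->
  (forall n, (1 <= n)%nat -> 0 <= f n <= 1) ->
  (forall n, (a < n)%nat -> f n = sum_1n n (fun j => p n j * f j)) ->
  (forall n, (1 <= n)%nat -> INR n * Rabs (f (S n) - f n) <= K) ->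
  exists eps D X, 0 < eps /\ 0 < D /\ 1 < al * X /\
    forall x, X <= x ->
      Rabs (f (nat_above x) - f (nat_above (al * x))) <=
      D * (Rpower (ln (al * x)) (- eps) - Rpower (ln x) (- eps)).
Proof.
intros Hc HK Hf01 Hf HfK.
destruct (condition1_log_error p al Hc) as (eps & C & N & He & HC & HN).
destruct Hc as (Hp & _ & _ & Hal & _).
set (L := eps * - ln al).
assert (HL : 0 < L).
{ apply Rmult_lt_0_compat; [lra|].
  assert (ln al < 0) by (rewrite <- ln_1; apply ln_increasing; lra); lra. }
destruct (log_error_small C eps (al / 2)) as (X1 & HX1 & Hs); [assumption|assumption|lra|].
(* [6 * K / al] is the Lipschitz cost of a distance [3 * w * n] above the level [al * n / 2]; the 1
   pays for the deviation probability. *)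
set (E := 6 * K / al + 1).
assert (HE : 1 <= E).
{ unfold E; assert (0 <= 6 * K / al) by (apply Rdiv_le_0_compat; lra); lra. }
set (X := X1 + INR N + INR a + 2 / al + 2).
assert (H2al : 2 / al * al = 2) by (field; lra).
assert (0 < 2 / al) by (apply Rdiv_lt_0_compat; lra).
pose proof (pos_INR N); pose proof (pos_INR a).
exists eps, (E * C / L), X; split; [assumption|split; [|split]].
- apply Rdiv_lt_0_compat; nra.
- unfold X; nra.
- intros x Hx; unfold X in Hx.
  assert (Halx : 2 <= al * x) by nra.
  pose proof (nat_above_spec x ltac:(lra)) as Hn.
  pose proof (nat_above_spec (al * x) ltac:(lra)) as Hm.
  set (n := nat_above x) in *; set (m := nat_above (al * x)) in *.
  assert (HnN : (N <= n)%nat) by (apply INR_le; lra).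
  assert (Hna : (a < n)%nat) by (apply INR_lt; lra).
  assert (Hn1 : (1 <= n)%nat) by lia.
  assert (Hm1 : (1 <= m)%nat) by (apply INR_lt; simpl; lra).
  destruct (HN n HnN) as (_ & Hd & Hwn).
  assert (Hwx : log_error C eps (INR n) <= log_error C eps x)
    by (apply log_error_antitone; lra).
  assert (Hwa : log_error C eps (INR n) <= al / 2) by (apply Hs; lra).
  pose proof (log_error_pos C eps (INR n) HC) as Hw.
  set (w := log_error C eps (INR n)) in *.
  assert (Hnear : Rabs (f n - f m) <= Rmax (6 * K / al * w) 0 + prob_dev p al w n).
  { rewrite (Hf n Hna); apply mean_near; try assumption.
    - intros j Hj; pose proof (Hf01 j Hj); pose proof (Hf01 m Hm1); apply Rabs_le; lra.
    - intros j Hj Hjn; apply Rabs_le_between in Hjn.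
      eapply Rle_trans; [apply lipschitz_of_increments_above with (K := K) (z := al * INR n / 2);
        try assumption; nra|].
      (* The window radius is [w * n]; the two roundings, of [x] and of [al * x], add at most
         [w * n] each because [1 <= w * n]. *)
      assert (Hjm : Rabs (INR j - INR m) <= 3 * (w * INR n)).
      { apply Rabs_le; split; nra. }
      apply Rle_trans with (K * (3 * (w * INR n)) / (al * INR n / 2)).
      + apply Rmult_le_compat_r; [left; apply Rinv_0_lt_compat; nra|].
        now apply Rmult_le_compat_l.
      + right; field; lra. }
  rewrite Rmax_left in Hnear
    by (apply Rmult_le_pos; [apply Rdiv_le_0_compat; lra|lra]).
  assert (Hi : / (INR n * INR n) <= 1).
  { rewrite <- Rinv_1; apply Rinv_le_contravar; nra. }
  pose proof (Rpower_ln_increment eps al x He Hal ltac:(lra)) as Hinc; fold L in Hinc.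
  assert (Rabs (f n - f m) <= E * log_error C eps x).
  { apply Rle_trans with (E * w); [unfold E; nra|].
    apply Rmult_le_compat_l; lra. }
  apply Rle_trans with (1 := H2).
  replace (E * log_error C eps x)
    with (E * C / L * (L * Rpower (ln x) (-1 - eps)))
    by (unfold log_error; field; lra).
  apply Rmult_le_compat_l; [|assumption].
  apply Rdiv_le_0_compat; nra.
Qed.

(** * The limit function and its properties *)

(** [Lim_seq] is total; that it is a genuine limit for [t > 0] is [scaling_limit_cv]. *)
Definition scaling_limit (f : nat -> R) (al t : R) : R :=
  Lim_seq (fun k => f (nat_above (t / al ^ k))).

Section ScalingLimit.

Variables (f : nat -> R) (al K eps D X : R).
Hypothesis Hal : 0 < al < 1.
Hypothesis HK : 0 <= K.
Hypothesis Hf01 : forall n, (1 <= n)%nat -> 0 <= f n <= 1.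
Hypothesis HfK : forall n, (1 <= n)%nat -> INR n * Rabs (f (S n) - f n) <= K.
Hypothesis Heps : 0 < eps.
Hypothesis HD : 0 < D.
Hypothesis HX : 1 < al * X.
Hypothesis Hdefect : forall x, X <= x ->
  Rabs (f (nat_above x) - f (nat_above (al * x))) <=
  D * (Rpower (ln (al * x)) (- eps) - Rpower (ln x) (- eps)).

Let u t k := f (nat_above (t / al ^ k)).
Let h t k := Rpower (ln (t / al ^ k)) (- eps).

Lemma scaling_step t k : X <= t ->
  h t (S k) <= h t k /\ Rabs (u t (S k) - u t k) <= D * (h t k - h t (S k)).
Proof.
intros Ht.
assert (Hk : 0 < al ^ k) by (apply pow_lt; lra).
assert (Hk1 : al ^ S k <= 1) by (rewrite <- (pow1 (S k)); apply pow_incr; lra).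
assert (HkS : 0 < al ^ S k) by (apply pow_lt; lra).
assert (HX0 : 0 < X) by nra.
assert (HtS : X <= t / al ^ S k) by (apply Rle_div_r; nra).
pose proof (Hdefect _ HtS) as Hd.
replace (al * (t / al ^ S k)) with (t / al ^ k) in Hd by (simpl; field; lra).
fold (u t k) (u t (S k)) (h t k) (h t (S k)) in Hd.
split; [|exact Hd].
(* The decrease of [h] follows from the defect bound itself: [D * (h t k - h t (S k))] dominates an
   absolute value and [D > 0]. *)
pose proof (Rabs_pos (u t (S k) - u t k)); nra.
Qed.

Lemma scaling_sequence_bound t k : X <= t ->
  Rabs (u t k - u t 0) <= D * (h t 0 - h t k).
Proof.
intros Ht; induction k as [|k IH].
- rewrite 2!Rminus_diag, Rabs_R0; lra.
- destruct (scaling_step t k Ht) as [_ Hs].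
  replace (u t (S k) - u t 0) with ((u t (S k) - u t k) + (u t k - u t 0)) by ring.
  eapply Rle_trans; [apply Rabs_triang|lra].
Qed.

Lemma scaling_sequence_cv_large t : X <= t -> ex_finite_lim_seq (u t).
Proof.
intros Ht.
assert (Ht0 : 0 < t) by nra.
assert (Hh0 : forall k, 0 < h t k) by (intros; apply exp_pos).
assert (Hu0 : forall k, 0 <= u t k).
{ intros k.
  assert (0 < t / al ^ k) by (apply Rdiv_lt_0_compat; [lra|apply pow_lt; lra]).
  pose proof (nat_above_spec _ H); apply Hf01, INR_lt; simpl; lra. }
(* Both [h] and [u + D h] are decreasing and nonnegative. *)
destruct (ex_finite_lim_seq_decr (h t) 0) as [l1 H1].
- intros k; now apply scaling_step.
- intros k; left; apply Hh0.
- destruct (ex_finite_lim_seq_decr (fun k => u t k + D * h t k) 0) as [l2 H2].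
  + intros k; destruct (scaling_step t k Ht) as [_ Hs].
    apply Rabs_le_between in Hs; lra.
  + intros k; specialize (Hh0 k); specialize (Hu0 k); nra.
  + exists (l2 - D * l1).
    apply is_lim_seq_ext with (fun k => (u t k + D * h t k) - D * h t k); [intros; ring|].
    apply is_lim_seq_minus'; [assumption|].
    now apply (is_lim_seq_scal_l (h t) D l1).
Qed.

Lemma scaling_sequence_shift t n k : u t (k + n) = u (t / al ^ n) k.
Proof.
unfold u; rewrite pow_add; do 2 f_equal.
assert (al ^ k <> 0) by (apply pow_nonzero; lra).
assert (al ^ n <> 0) by (apply pow_nonzero; lra).
field; lra.
Qed.

Lemma scaling_limit_cv t : 0 < t -> is_lim_seq (u t) (scaling_limit f al t).
Proof.
intros Ht; apply Lim_seq_correct'.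
assert (HX0 : 0 < X) by nra.
(* A small [t] is first moved beyond [X] by dividing by [al^n], which only drops the first [n] terms
   of the sequence. *)
destruct (pow_lt_1_zero al ltac:(rewrite Rabs_right; lra) (t / X)) as [n Hn];
  [now apply Rdiv_lt_0_compat|].
assert (Hlarge : ex_finite_lim_seq (u (t / al ^ n))).
{ apply scaling_sequence_cv_large.
  assert (0 < al ^ n) by (apply pow_lt; lra).
  specialize (Hn n ltac:(lia)); rewrite Rabs_right in Hn by lra.
  apply Rle_div_r; [lra|]; apply Rlt_div_r in Hn; lra. }
destruct Hlarge as [l Hl]; exists l.
apply (is_lim_seq_incr_n (u t) n).
apply is_lim_seq_ext with (2 := Hl).
intros k; symmetry; apply scaling_sequence_shift.
Qed.

(** Replacing [t] by [al * t] shifts the sequence by one index. *)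
Lemma scaling_limit_periodic t : 0 < t ->
  scaling_limit f al (al * t) = scaling_limit f al t.
Proof.
intros Ht; unfold scaling_limit; rewrite <- Lim_seq_incr_1.
f_equal; apply Lim_seq_ext; intros k; simpl; do 2 f_equal.
assert (al ^ k <> 0) by (apply pow_nonzero; lra).
field; lra.
Qed.

(** At scale [al^k] the factors in [Rabs (x - y) / z] cancel, while the rounding error becomes
    [K / z * al^k] and vanishes. *)
Lemma scaling_limit_lipschitz x y z : 0 < z -> z <= x -> z <= y ->
  Rabs (scaling_limit f al x - scaling_limit f al y) <= K * Rabs (x - y) / z.
Proof.
intros Hz Hx Hy.
assert (H : Rbar_le (Finite (Rabs (scaling_limit f al x - scaling_limit f al y)))
                    (Finite (K * Rabs (x - y) / z + K / z * 0))).
{ apply is_lim_seq_le with (fun k => Rabs (u x k - u y k))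
    (fun k => K * Rabs (x - y) / z + K / z * al ^ k).
  - intros k; assert (Hk : 0 < al ^ k) by (apply pow_lt; lra).
    assert (Hi : 0 < / al ^ k) by now apply Rinv_0_lt_compat.
    eapply Rle_trans; [apply lipschitz_nat_above with (K := K) (z := z / al ^ k); try assumption|].
    + now apply Rdiv_lt_0_compat.
    + apply Rmult_le_compat_r; lra.
    + apply Rmult_le_compat_r; lra.
    + replace (x / al ^ k - y / al ^ k) with ((x - y) * / al ^ k) by (field; lra).
      rewrite Rabs_mult, (Rabs_right (/ al ^ k)) by lra.
      right; field; lra.
  - apply is_lim_seq_abs with (l := Finite _), is_lim_seq_minus';
      apply scaling_limit_cv; lra.
  - apply is_lim_seq_plus'; [apply is_lim_seq_const|].
    apply (is_lim_seq_scal_l (fun k => al ^ k) (K / z) 0).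
    apply is_lim_seq_geom; rewrite Rabs_right; lra. }
simpl in H; lra.
Qed.

Lemma scaling_limit_near t : X <= t ->
  Rabs (scaling_limit f al t - f (nat_above t)) <= D * Rpower (ln t) (- eps).
Proof.
intros Ht.
assert (Ht0 : 0 < t) by nra.
assert (H : Rbar_le (Finite (Rabs (scaling_limit f al t - u t 0))) (Finite (D * h t 0))).
{ apply is_lim_seq_le with (fun k => Rabs (u t k - u t 0)) (fun _ => D * h t 0).
  - intros k; pose proof (scaling_sequence_bound t k Ht).
    assert (0 < h t k) by apply exp_pos; nra.
  - apply is_lim_seq_abs with (l := Finite _), is_lim_seq_minus';
      [now apply scaling_limit_cv|apply is_lim_seq_const].
  - apply is_lim_seq_const. }
unfold u, h in H; simpl in H; rewrite Rdiv_1_r in H; exact H.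
Qed.

Lemma scaling_limit_loc_lipschitz : loc_lipschitz_pos (scaling_limit f al).
Proof.
intros t Ht; exists (t / 2), (K / (t / 2)); split; [lra|].
intros x y Hx Hy Hxt Hyt.
apply Rabs_lt_between in Hxt; apply Rabs_lt_between in Hyt.
eapply Rle_trans; [apply scaling_limit_lipschitz with (z := t / 2); lra|].
right; field; lra.
Qed.

Lemma scaling_limit_asymptotic :
  Un_cv (fun n => f n - scaling_limit f al (INR n)) 0.
Proof.
intros e He.
destruct (Rpower_ln_small eps (e / 2 / (D + 1))) as (X1 & HX1 & Hs); [assumption| |].
{ apply Rdiv_lt_0_compat; lra. }
assert (HX0 : 0 < X) by nra.
assert (HKe : 0 <= 4 * K / e) by (apply Rdiv_le_0_compat; lra).
(* The three summands serve the bound near the limit function, [D * ln^(-eps) <= e / 2], and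
   [K / n <= e / 4]. *)
destruct (INR_unbounded (X + X1 + 4 * K / e)) as [n0 Hn0].
exists n0; intros n Hn; apply le_INR in Hn; unfold Rdist; rewrite Rminus_0_r.
assert (Hh := Hs (INR n) ltac:(lra)).
apply Rle_div_r in Hh; [|lra].
pose proof (scaling_limit_near (INR n) ltac:(lra)) as Hnear.
assert (0 < Rpower (ln (INR n)) (- eps)) by apply exp_pos.
pose proof (nat_above_spec (INR n) ltac:(lra)) as [Hu1 Hu2].
(* Rounding at an integer overshoots by one, so [f (S n)] is compared with the limit and one
   increment is paid. *)
assert (HS : nat_above (INR n) = S n).
{ apply INR_lt in Hu1; rewrite <- S_INR in Hu2; apply INR_le in Hu2; lia. }
rewrite HS in Hnear.
assert (Hinc := HfK n ltac:(apply INR_lt; simpl; lra)).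
assert (Rabs (f (S n) - f n) <= e / 4).
{ assert (HKn : K <= INR n * (e / 4)).
  { replace K with (4 * K / e * (e / 4)) by (field; lra); nra. }
  apply Rmult_le_reg_l with (INR n); lra. }
replace (f n - scaling_limit f al (INR n))
  with (- (f (S n) - f n) - (scaling_limit f al (INR n) - f (S n))) by ring.
eapply Rle_lt_trans; [apply Rabs_triang|]; rewrite 2!Rabs_Ropp; nra.
Qed.

End ScalingLimit.

(** * Continuity, and application to the stopped process *)

Lemma loc_lipschitz_continuity f t : loc_lipschitz_pos f -> 0 < t -> continuity_pt f t.
Proof.
intros Hf Ht; destruct (Hf t Ht) as (r & L & Hr & HL).
assert (HL' : 0 < Rabs L + 1) by (pose proof (Rabs_pos L); lra).
(* The radius [t] keeps [x] positive; [Rabs L + 1] replaces [L], which may be zero or negative. *)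
intros e He; exists (Rmin (Rmin r t) (e / (Rabs L + 1))); split.
- apply Rmin_glb_lt; [apply Rmin_glb_lt; lra|apply Rdiv_lt_0_compat; lra].
- intros x [_ Hx]; simpl in *; unfold Rdist in *.
  assert (Hx1 : Rabs (x - t) < r)
    by (eapply Rlt_le_trans; [exact Hx|eapply Rle_trans; [apply Rmin_l|apply Rmin_l]]).
  assert (Hx2 : Rabs (x - t) < t)
    by (eapply Rlt_le_trans; [exact Hx|eapply Rle_trans; [apply Rmin_l|apply Rmin_r]]).
  assert (Hx3 : Rabs (x - t) < e / (Rabs L + 1))
    by (eapply Rlt_le_trans; [exact Hx|apply Rmin_r]).
  apply Rlt_div_r in Hx3; [|lra].
  apply Rabs_lt_between in Hx2.
  eapply Rle_lt_trans; [apply HL; try assumption; try lra; rewrite Rminus_diag, Rabs_R0; lra|].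
  pose proof (Rle_abs L); pose proof (Rabs_pos (x - t)); nra.
Qed.

Lemma stopped_prob_bounds p a k n i : is_law p -> (1 <= n)%nat ->
  0 <= stopped_prob p a k n i <= 1.
Proof.
intros Hp; revert n; induction k as [|k IH]; intros n Hn; simpl.
- destruct (Nat.eqb n i); lra.
- destruct (n <=? a)%nat; [destruct (Nat.eqb n i); lra|].
  destruct (Hp n Hn) as [H0 <-]; split.
  + apply sum_1n_nonneg; intros j Hj; apply Rmult_le_pos; [apply H0|apply IH; lia].
  + apply sum_1n_le; intros j Hj; specialize (H0 j); specialize (IH j ltac:(lia)); nra.
Qed.

Lemma stopped_prob_limit_bounds p a n i l : is_law p -> (1 <= n)%nat ->
  Un_cv (fun k => stopped_prob p a k n i) l -> 0 <= l <= 1.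
Proof.
intros Hp Hn Hl; apply is_lim_seq_Reals in Hl; split.
- apply (is_lim_seq_le (fun _ => 0) (fun k => stopped_prob p a k n i) 0 l);
    [intros; now apply stopped_prob_bounds|apply is_lim_seq_const|assumption].
- apply (is_lim_seq_le (fun k => stopped_prob p a k n i) (fun _ => 1) l 1);
    [intros; now apply stopped_prob_bounds|assumption|apply is_lim_seq_const].
Qed.

(** Above [a] the first-step recursion is a finite sum, so it passes to the limit; the left side
    converges to the same limit with [k] shifted by one. *)
Lemma stopped_prob_limit_harmonic p a n i (l : nat -> R) : (a < n)%nat ->
  (forall j, (1 <= j <= n)%nat -> Un_cv (fun k => stopped_prob p a k j i) (l j)) ->
  l n = sum_1n n (fun j => p n j * l j).
Proof.
intros Hn Hl; apply UL_sequence with (fun k => stopped_prob p a (S k) n i).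
- apply is_lim_seq_Reals.
  apply (is_lim_seq_incr_1 (fun k => stopped_prob p a k n i) (l n)).
  apply is_lim_seq_Reals, Hl; lia.
- simpl; destruct (Nat.leb_spec n a); [lia|].
  apply (sum_1n_cv n (fun k j => p n j * stopped_prob p a k j i)); intros j Hj.
  apply (CV_mult (fun _ => p n j)); [apply is_lim_seq_Reals, is_lim_seq_const|now apply Hl].
Qed.

Theorem theorem2p2 (p : nat -> nat -> R) (alpha : R) (a : nat)
  (pi : nat -> nat -> R) :
  condition1 p alpha ->
  (1 <= a)%nat ->
  (* pi n i = Pr(the stopped process started at n ends with i players)
     = lim_k Pr(T <= k and N_T = i) *)
  (forall n i : nat, (1 <= n)%nat -> (1 <= i <= a)%nat ->
     Un_cv (fun k => stopped_prob p a k n i) (pi n i)) ->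
  exists psi : nat -> R -> R,
    forall i : nat, (1 <= i <= a)%nat ->
      (forall t, 0 < t -> continuity_pt (psi i) t) /\
      loc_lipschitz_pos (psi i) /\
      (forall t, 0 < t -> psi i (alpha * t) = psi i t) /\
      Un_cv (fun n => pi n i - psi i (INR n)) 0.
Proof.
intros Hc Ha Hpi.
exists (fun i => scaling_limit (fun n => pi n i) alpha); intros i Hi.
set (f := fun n => pi n i).
assert (Hp : is_law p) by apply Hc.
assert (Hal : 0 < alpha < 1) by apply Hc.
assert (Hf01 : forall n, (1 <= n)%nat -> 0 <= f n <= 1).
{ intros n Hn; apply (stopped_prob_limit_bounds p a n i); try assumption; now apply Hpi. }
assert (Hf : forall n, (a < n)%nat -> f n = sum_1n n (fun j => p n j * f j)).
{ intros n Hn; apply (stopped_prob_limit_harmonic p a n i f Hn).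
  intros j Hj; apply Hpi; [lia|assumption]. }
destruct (increment_bound p alpha a f Hc Hf01 Hf) as (K & HK & HfK).
destruct (scaling_defect p alpha a f K Hc (Rlt_le _ _ HK) Hf01 Hf HfK)
  as (eps & D & X & He & HD & HX & Hdef).
assert (HK0 := Rlt_le _ _ HK).
assert (HLip : loc_lipschitz_pos (scaling_limit f alpha))
  by now apply scaling_limit_loc_lipschitz with (K := K) (eps := eps) (D := D) (X := X).
split; [|split; [|split]].
- intros t Ht; now apply loc_lipschitz_continuity.
- assumption.
- intros t Ht; now apply scaling_limit_periodic.
- now apply scaling_limit_asymptotic with (K := K) (eps := eps) (D := D) (X := X).
Qed.
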